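(* Let $\psi$ be any structural parameter such that for every $\omega$ there is a CSP instance $\mathbf{I}$ with $\psi(\mathbf{I})=\psi(H(\mathbf{I}))\geq \omega$. Then for every $\omega$ there is a CSP instance $\mathbf{I}_\omega$ with $\mathsf{jw}(\mathbf{I}_\omega)\leq 1$ but $\psi(\mathbf{I}_\omega)\geq \omega$.
   Context: A structural parameter is a real-valued parameter $\psi$ of CSP instances that is measured purely on the hypergraph, i.e. $\psi(\mathbf{I})=\psi(H(\mathbf{I}))$ for every CSP instance $\mathbf{I}$, where $H(\mathbf{I})$ is the hypergraph with vertex set $V$ and edge set $\{S(c): c\in C\}$. CSP. A CSP instance $\mathbf{I}=\langle V,D,C\rangle$ consists of a finite set $V$ of variables, a finite domain $D$ and a set $C$ of constraints. A constraint $c$ has a scope $S(c)$ (a totally ordered subset of $V$) and a (possibly empty) relation $R(c)\subseteq D^{|S(c)|}$; $|c|$ is the number of tuples in $R(c)$. It is assumed that every variable occurs in the scope of at least one constraint. For $t\in R(c)$ and $v\in S(c)$, $t[v]$ is the entry of $t$ at the position of $v$; $t[V']$ is the restriction of $t$ to the variables in $S(c)\cap V'$. $\sharp_{\mathrm{tup}}(\mathbf{I})$ is the maximum number of tuples in any constraint relation of $\mathbf{I}$. The join $c\bowtie c'$ is the constraint with scope $S(c)\cup S(c')$ (first $S(c)$, then $S(c')\setminus S(c)$) whose tuples are the combinations of $t\in R(c)$ and $t'\in R(c')$ that agree on $S(c)\cap S(c')$. The projection $\pi_{V'}(c)$ has scope $S(c)\cap V'$ and relation $\{t[V'] : t\in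 R(c)\}$ (so for $S(c)\cap V'=\emptyset$ it contains just the empty tuple if $R(c)\neq\emptyset$, and no tuple otherwise). Join decompositions. A join decomposition for $\mathbf{I}$ is a pair $(J,\varrho)$ where $J$ is a rooted binary tree and $\varrho$ is a bijection between the leaves of $J$ and $C$. For a node $j$ of $J$, let $X(j)$ be the set of constraints $\varrho(\ell)$ over leaves $\ell$ of the subtree rooted at $j$, $V(j)=\bigcup_{c\in X(j)}S(c)$ and $\overline{V}(j)=\bigcup_{c\in C\setminus X(j)}S(c)$. Define $C_{proj}(j)=\pi_{\overline{V}(j)}(\varrho(j))$ if $j$ is a leaf, and $C_{proj}(j)=\pi_{\overline{V}(j)}(C_{proj}(j_1)\bowtie C_{proj}(j_2))$ if $j$ has children $j_1,j_2$. For a constraint $c$, $\mathsf{prune}(c)$ is obtained from $c$ by removing all tuples $t\in R(c)$ for which there is a constraint $c'\in C$ with $t[S(c')]\notin \pi_{S(c)}(c')$. Set $C(j)=\mathsf{prune}(C_{proj}(j))$. The joinwidth $\mathsf{jw}(j)$ of $j$ is the smallest real $\omega$ with $|C(j)|\leq (\sharp_{\mathrm{tup}}(\mathbf{I}))^{\omega}$, i.e. $\log_{\sharp_{\mathrm{tup}}(\mathbf{I})}|C(j)|$. The width (joinwidth) of a join decomposition is the maximum of $\mathsf{jw}(j)$ over its nodes (so width at most $\omega$ means $|C(j)|\le(\sharp_{\mathrm{tup}}(\mathbf{I}))^\omega$ for all nodes $j$), and $\mathsf{jw}(\mathbf{I})$ is the minimum width over all join decompositions of $\mathbf{I}$. 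*)

(* Defs.v *)
From HB Require Import structures.
From mathcomp Require Import all_boot all_order all_algebra finmap.
From mathcomp Require Import boolp classical_sets reals constructive_ereal ereal exp.

Set Implicit Arguments.
Unset Strict Implicit.
Unset Printing Implicit Defensive.

Import Order.TTheory GRing.Theory Num.Theory.

Local Open Scope nat_scope.
Local Open Scope fset_scope.
Local Open Scope set_scope.

(* A scope is a totally ordered subset of the variables, i.e. a
   duplicate-free sequence. *)
Definition scopeOf (V : finType) := {s : seq V | uniq s}.

Definition constraint (V D : finType) :=
  {s : scopeOf V & {set (size (val s)).-tuple D}}.

HB.instance Definition _ (V D : finType) :=
  Choice.copy (constraint V D) {s : scopeOf V & {set (size (val s)).-tuple D}}.

Section Constraints.
Variables V D : finType.
Implicit Types (c : constraint V D) (W : {set V}).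

Definition scope c : seq V := val (tag c).

Definition relation c : {set (size (scope c)).-tuple D} := tagged c.

Definition scopeSet c : {set V} := [set v in scope c].

Definition mkConstraint (s : seq V) (us : uniq s)
    (r : {set (size s).-tuple D}) : constraint V D :=
  existT _ (exist _ s us : scopeOf V) r.

(* t[v] is [Some] of the entry of t at the position of v in the scope s, and
   [None] when v is not in s (then [index v s = size s]); the option avoids a
   default value, as the domain may be empty. *)
Definition entry (s : seq V) (t : (size s).-tuple D) (v : V) : option D :=
  onth t (index v s).

(* Tuples over different scopes are compared as assignments of the variables:
   the same variable may sit at different positions in the two scopes. *)
Definition agreeOn W (s s' : seq V)
    (t : (size s).-tuple D) (t' : (size s').-tuple D) : bool :=
  [forall v in W, entry t v == entry t' v].

Definition joinScope c c' : seq V :=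
  scope c ++ [seq v <- scope c' | v \notin scope c].

Lemma joinScope_uniq c c' : uniq (joinScope c c').
Proof.
rewrite cat_uniq (valP (tag c)) filter_uniq ?(valP (tag c')) // andbT.
by apply/hasPn => v; rewrite mem_filter => /andP[].
Qed.

(* A tuple u over S(c) ++ (S(c') \ S(c)) is the combination of t and t' when it
   agrees with t on S(c) and with t' on S(c'); it exists iff t and t' agree on
   the common variables. *)
Definition join c c' : constraint V D :=
  mkConstraint (joinScope_uniq c c')
    [set u | [exists t in relation c, [exists t' in relation c',
       agreeOn (scopeSet c) u t && agreeOn (scopeSet c') u t']]].

Definition projScope W c : seq V := [seq v <- scope c | v \in W].

Lemma projScope_uniq W c : uniq (projScope W c).
Proof. by rewrite filter_uniq // (valP (tag c)). Qed.

Definition proj W c : constraint V D :=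
  mkConstraint (projScope_uniq W c)
    [set u | [exists t in relation c, agreeOn (scopeSet c :&: W) u t]].

(* The condition t[S(c')] \in \pi_{S(c)}(c'), both sides being assignments of
   S(c) :&: S(c'). *)
Definition restrInProj c (t : (size (scope c)).-tuple D) c' : bool :=
  [exists t' in relation (proj (scopeSet c) c'),
     agreeOn (scopeSet c :&: scopeSet c') t t'].

Definition prune (C : {fset constraint V D}) c : constraint V D :=
  mkConstraint (valP (tag c))
    (relation c :\: [set t | has (fun c' => ~~ restrInProj t c') C]).

End Constraints.

(* Variables are drawn from an arbitrary universe U, so that hypergraphs are
   compared as sets and a parameter of hypergraphs needs no invariance under
   isomorphism. *)
Record csp (U : choiceType) := Csp {
  csp_var : {fset U};
  csp_dom : finType;
  csp_con : {fset constraint csp_var csp_dom};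
  csp_cover : forall v : csp_var, exists2 c, c \in csp_con & v \in scope c }.

Definition maxTuples (U : choiceType) (I : csp U) : nat := \max_(c <- csp_con I) #|relation c|.

Record hypergraph (U : choiceType) := Hypergraph {
  hg_vertex : {fset U};
  hg_edges : {set {set hg_vertex}} }.

Definition hypergraphOf (U : choiceType) (I : csp U) : hypergraph U :=
  Hypergraph [set e | has (fun c => e == scopeSet c) (csp_con I)].

Definition structuralParameter (U : choiceType) (R : realType)
    (psi : csp U -> R) : Prop :=
  exists f : hypergraph U -> R, forall I : csp U, psi I = f (hypergraphOf I).

(* Rooted binary trees with labelled leaves; a node of the tree is identified
   with the subtree rooted at it. *)
Inductive joinTree (T : Type) : Type :=
| JLeaf of T
| JNode of joinTree T & joinTree T.

Fixpoint leaves (T : Type) (j : joinTree T) : seq T :=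
  match j with
  | JLeaf c => [:: c]
  | JNode j1 j2 => leaves j1 ++ leaves j2
  end.

Fixpoint nodes (T : Type) (j : joinTree T) : seq (joinTree T) :=
  j :: match j with
       | JLeaf _ => [::]
       | JNode j1 j2 => nodes j1 ++ nodes j2
       end.

Section JoinDecompositions.
Variables (U : choiceType) (I : csp U).
Local Notation con := (constraint (csp_var I) (csp_dom I)).
Implicit Types J j : joinTree con.

(* The leaf labelling is a bijection onto the constraints of I: every
   constraint labels exactly one leaf. *)
Definition joinDecomposition J : Prop := perm_eq (leaves J) (csp_con I).

Definition Xof j : {fset con} := [fset c in leaves j].

Definition Vbar j : {set csp_var I} :=
  [set v | has (fun c => v \in scope c) (csp_con I `\` Xof j)].

Fixpoint Cproj j : con :=
  match j with
  | JLeaf c => proj (Vbar j) c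
  | JNode j1 j2 => proj (Vbar j) (join (Cproj j1) (Cproj j2))
  end.

Definition Cof j : con := prune (csp_con I) (Cproj j).

End JoinDecompositions.

Section JoinWidth.
Variables (R : realType) (U : choiceType) (I : csp U).
Local Notation con := (constraint (csp_var I) (csp_dom I)).
Local Open Scope ring_scope.
Local Open Scope ereal_scope.

(* The least w with |C(j)| <= #tup ^ w, taken in the extended reals: it is
   log_{#tup} |C(j)|, and -oo when |C(j)| = 0 or #tup <= 1, where every real w
   is admissible. *)
Definition jwNode (j : joinTree con) : \bar R :=
  ereal_inf [set w%:E | w in
    [set w : R | (#|relation (Cof j)|%:R <= (maxTuples I)%:R `^ w)%R]%classic]%classic.

Definition jwDecomp (J : joinTree con) : \bar R :=
  \big[maxe/-oo]_(j <- nodes J) jwNode j.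

(* I has finitely many join decompositions, so the infimum is a minimum if there
   is one; it is +oo if I has no constraint, hence no join decomposition. *)
Definition jw : \bar R :=
  ereal_inf [set jwDecomp J | J in [set J | joinDecomposition J]%classic]%classic.

End JoinWidth.

(* Main.v *)
(** Over a one-element domain every relation has at most one tuple. Replacing
    all relations of an instance by the full relation over such a domain keeps
    the hypergraph and makes every join decomposition have width at most 1.
    An instance without constraints has no join decomposition at all, but all
    such instances share the empty hypergraph, hence a single value of [psi],
    and are avoided by asking for a larger value. *)
Require Import Defs.
From mathcomp Require Import all_boot all_order all_algebra.
From mathcomp Require Import reals constructive_ereal.
From mathcomp Require Import finmap classical_sets ereal exp.

Import Order.TTheory GRing.Theory Num.Theory.
Local Open Scope ring_scope.

(** A right comb carries the labels in order. Applied to the constraints, it supplies a join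
    decomposition. *)
Lemma exists_joinTree_leaves (T : Type) (s : seq T) :
  s <> [::] -> exists J : joinTree T, leaves J = s.
Proof.
elim: s => // x [|y s] IHs _; first by exists (JLeaf x).
by have [//|J eJ] := IHs; exists (JNode (JLeaf x) J); rewrite /= eJ.
Qed.

Lemma card_relation_unit (V : finType) (c : constraint V unit) :
  (#|relation c| <= 1)%N.
Proof. by rewrite (leq_trans (max_card _)) // card_tuple card_unit exp1n. Qed.

(** The nonempty relation of [c] makes [maxTuples] exactly 1, and no node can hold more than one
    tuple, so any tree will do. *)
Lemma jw_le1_unit_nonempty (R : realType) (U : choiceType) (V : {fset U})
    (C : {fset constraint V unit})
    (cov : forall v : V, exists2 c, c \in C & v \in scope c)
    (c : constraint V unit) :
  c \in C -> (0 < #|relation c|)%N -> (jw R (Csp cov) <= 1%:E)%E.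
Proof.
move=> cC c_gt0; set I := Csp cov.
have max1 : maxTuples I = 1%N.
  apply/eqP; rewrite eqn_leq; apply/andP; split.
    by apply/bigmax_leqP_seq => d _ _; apply: card_relation_unit.
  by apply: leq_trans c_gt0 _; rewrite /maxTuples (leq_bigmax_seq c).
have [J eJ] : exists J : joinTree (constraint V unit), leaves J = C.
  by apply: exists_joinTree_leaves => C0; have: c \in (C : seq _) := cC; rewrite C0.
apply: (@le_trans _ _ (jwDecomp R (I := I) J)).
  by apply: ereal_inf_lbound; exists J => //; rewrite /= /joinDecomposition eJ.
apply: bigmax_le => [|j _]; first exact: leNye.
(* The exponent 1 is admissible at every node, as its bound is a power of 1. *)
apply: ereal_inf_lbound; exists 1 => //=.
by rewrite max1 powR1 lern1 card_relation_unit.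
Qed.

Definition trivialConstraint (V D : finType) (c : constraint V D) :
    constraint V unit :=
  mkConstraint (valP (tag c)) [set: _].

Lemma trivialize_cover (U : choiceType) (I : csp U) (v : csp_var I) :
  exists2 c, c \in [fset trivialConstraint _ _ c | c in csp_con I]%fset
             & v \in scope c.
Proof.
have [c cI vc] := csp_cover v.
by exists (trivialConstraint _ _ c); first exact: in_imfset.
Qed.

Definition trivialize (U : choiceType) (I : csp U) : csp U :=
  Csp (@trivialize_cover U I).

(** Constraints with the same scope merge, but the edges form a set of scopes, so no edge is
    lost. *)
Lemma hypergraphOf_trivialize (U : choiceType) (I : csp U) :
  hypergraphOf (trivialize U I) = hypergraphOf I.
Proof.
rewrite /hypergraphOf /=; congr Hypergraph; apply/setP => e; rewrite !inE.
apply/hasP/hasP => [[_ /imfsetP[c /= cI ->] ec]|[c cI ec]]; first by exists c.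
by exists (trivialConstraint _ _ c); first exact: in_imfset.
Qed.

Lemma jw_trivialize_le1 (R : realType) (U : choiceType) (I : csp U) :
  csp_con I != fset0 -> (jw R (trivialize U I) <= 1%:E)%E.
Proof.
case/fset0Pn => c cI.
apply: (@jw_le1_unit_nonempty _ _ _ _ _ (trivialConstraint _ _ c)).
  exact: in_imfset.
by rewrite cardsT card_tuple card_unit exp1n.
Qed.

(** Every variable lies in some scope, so without constraints there are no variables either. *)
Lemma hypergraphOf_no_constraint (U : choiceType) (I : csp U) :
  csp_con I = fset0 -> hypergraphOf I = @Hypergraph U fset0 finset.set0.
Proof.
case: I => V D C cov /= C0.
have V0 : V = fset0.
  apply/eqP/fset0Pn => -[x xV].
  by have [c] := cov [` xV]%fset; rewrite C0 inE.
by rewrite /hypergraphOf /=; subst V C; congr Hypergraph.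
Qed.

Theorem mainTheorem4 (R : realType) (U : choiceType) (psi : csp U -> R)
    (psi_structural : structuralParameter psi)
    (psi_unbounded : forall omega : R, exists I : csp U, omega <= psi I) :
  forall omega : R, exists I : csp U, (jw R I <= 1%:E)%E /\ omega <= psi I.
Proof.
move=> omega; have [f psiE] := psi_structural.
set e := f (@Hypergraph U fset0 finset.set0).
(* The summand 1 forces [psi I] strictly above [e], the value at the empty hypergraph. *)
have [I] := psi_unbounded (Num.max omega (e + 1)).
rewrite ge_max => /andP[omegaI eI].
exists (trivialize U I); split; last by rewrite psiE hypergraphOf_trivialize -psiE.
apply: jw_trivialize_le1; apply/eqP => I0; move: eI.
by rewrite psiE hypergraphOf_no_constraint // -/e gerDl ler10.
Qed.
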